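(* Let $n=2k$ where $k\in\mathbb{N}\setminus\{1\}$ (that is, $k\ge 2$ is an integer). Then a magic $n$-gon exists.
   Context: Let $n\ge 3$ and consider a regular $n$-gon with $2n+1$ nodes: the vertices $v_1,\dots,v_n$ (in clockwise order), the midpoints $m_1,\dots,m_n$ of the sides ($m_i$ is the midpoint of the side joining $v_i$ and $v_{i+1}$, with $v_{n+1}:=v_1$), and the center $c$. The sides are the $n$ triples of nodes $\{v_i,m_i,v_{i+1}\}$, $1\le i\le n$. The diagonals are the $n$ triples of nodes lying on a line through the center: if $n$ is even these are $\{v_i,c,v_{i+n/2}\}$ and $\{m_i,c,m_{i+n/2}\}$ for $1\le i\le n/2$; if $n$ is odd these are $\{v_i,c,m_{i+(n-1)/2}\}$ for $1\le i\le n$ (indices modulo $n$), i.e. each diagonal joins a vertex, the center, and the midpoint of the opposite side. A magic $n$-gon is an arrangement (bijective assignment) of the numbers $1,2,\dots,2n+1$ to the $2n+1$ nodes such that the sum of the three numbers on each side and the sum of the three numbers on each diagonal are all equal to one common value, called the magic sum. Here $\mathbb{N}=\{1,2,3,\dots\}$. *)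

(* Defs.v *)
From mathcomp Require Import all_boot.

Set Implicit Arguments.
Unset Strict Implicit.
Unset Printing Implicit Defensive.

(* The nodes of the n-gon; indices are 0-based, so that vertex i, midpoint i
   stand for v_(i+1), m_(i+1) when those are numbered from 1 to n. *)
Definition node (n : nat) : finType := ('I_n + 'I_n + unit)%type.

Definition vertex n (i : 'I_n) : node n := inl (inl i).
Definition midpoint n (i : 'I_n) : node n := inl (inr i).
Definition center n : node n := inr tt.

Lemma cyc_shift_subproof n (i : 'I_n) (d : nat) : (i + d) %% n < n.
Proof. by rewrite ltn_pmod // (leq_ltn_trans _ (ltn_ord i)). Qed.

Definition cyc_shift n (i : 'I_n) (d : nat) : 'I_n :=
  Ordinal (cyc_shift_subproof i d).

Definition side n (i : 'I_n) : {set node n} :=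
  [set vertex i; midpoint i; vertex (cyc_shift i 1)].

Definition sides n : {set {set node n}} := [set side i | i : 'I_n].

Definition even_diagonals n : {set {set node n}} :=
  [set [set vertex i; center n; vertex (cyc_shift i n./2)]
     | i : 'I_n & i < n./2] :|:
  [set [set midpoint i; center n; midpoint (cyc_shift i n./2)]
     | i : 'I_n & i < n./2].

Definition odd_diagonals n : {set {set node n}} :=
  [set [set vertex i; center n; midpoint (cyc_shift i n.-1./2)] | i : 'I_n].

Definition diagonals n : {set {set node n}} :=
  if odd n then odd_diagonals n else even_diagonals n.

Definition arrangement n (f : node n -> nat) : Prop :=
  injective f /\ codom f =i iota 1 (2 * n + 1).

Definition magic_sum n (f : node n -> nat) (S : nat) : Prop :=
  forall T : {set node n},
    T \in sides n :|: diagonals n -> \sum_(x in T) f x = S.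

Definition magic_ngon n (f : node n -> nat) : Prop :=
  [/\ 3 <= n, arrangement f & exists S : nat, magic_sum f S].

(* Main.v *)
Require Import Defs.
From mathcomp Require Import all_boot.
From mathcomp Require Import ssralg ssrint zify.

Set Implicit Arguments.
Unset Strict Implicit.
Unset Printing Implicit Defensive.

Import GRing.Theory.

(** Put [n + 1] at the center and subtract [n + 1] from every number, so that the
numbers to be placed become the integers from [-n] to [n], the center carries
[0], and all lines are to have sum zero.  The diagonals then say that
antipodal nodes carry opposite values, and the sides say that each midpoint
carries minus the sum of its two neighbours.  With [n = 2k], such a filling is
determined by the offsets [a_0, ..., a_(k-1)] of the first [k] vertices,
continued by [a_(i+k) = - a_i], and it is a bijection exactly when the [2k]
magnitudes [|a_i|] and [|a_i + a_(i+1)|], for [i < k], are [1, ..., 2k] in some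
order ([magic_of_offsets]).

One choice that works for every [k >= 2] is the zigzag
  [k+1, -2k, k+2, -(2k-1), k+3, ...]  ([k-1] terms), followed by [1].
The [k-2] neighbouring sums inside the zigzag have magnitudes [k-1, ..., 2].
The positive terms climb from [k+1] and the magnitudes of the negative ones
descend from [2k] until one number [g = floor(3k/2) + 1] is left out in between.
The last term [1] supplies the magnitude [1]; the term before it is [g - 1] for
[k] even and [-(g + 1)] for [k] odd, so that adding [1] gives [g] in magnitude.
The wrap-around sum [a_(k-1) + a_k = 1 - (k+1)] supplies [k]
([zigzag_covers]). *)

Lemma sum_set3 (T : finType) (F : T -> nat) (x y z : T) :
  x != y -> x != z -> y != z ->
  \sum_(t in [set x; y; z]) F t = F x + F y + F z.
Proof.
move=> xy xz yz.
rewrite setUC big_setU1 ?inE ?negb_or 1?eq_sym ?xz 1?eq_sym ?yz //=.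
by rewrite big_setU1 ?inE // big_set1 addnC.
Qed.

Lemma card_node n : #|{: node n}| = 2 * n + 1.
Proof. by rewrite !card_sum card_ord card_unit; lia. Qed.

Lemma cyc_shift_neq n (i : 'I_n) d : 0 < d < n -> i != cyc_shift i d.
Proof.
move=> /andP [d_gt0 d_lt]; apply/eqP => /(congr1 val) /= /esym.
rewrite -{2}(modn_small (ltn_ord i)) -{2}[nat_of_ord i]addn0 => /eqP.
by rewrite eqn_modDl mod0n modn_small //; case: d d_gt0 {d_lt}.
Qed.

Section Offsets.

Variables (k : nat) (a : nat -> int).
Hypotheses (k_ge2 : 2 <= k) (a_anti : forall i, a (i + k) = (- a i)%R).

Let n := 2 * k.

Definition offset (x : node n) : int :=
  match x with
  | inl (inl i) => a i
  | inl (inr i) => (- (a i + a i.+1))%R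
  | inr _ => 0%R
  end.

Lemma antiperiodic_mod i : a (i %% n) = a i.
Proof.
have per j : a (j + n) = a j.
  by rewrite /n mul2n -addnn addnA !a_anti opprK.
rewrite [in RHS](divn_eq i n); elim: (i %/ n) => [|q IHq] //=.
by rewrite mulSn -addnA addnC per.
Qed.

Hypothesis a_covers : forall d, 0 < d <= n ->
  exists2 i, i < k & absz (a i) = d \/ absz (a i + a i.+1)%R = d.

(** A magnitude [d] is attained by a node among the first half of the polygon;
the antipodal node has the opposite offset, so both signs occur. *)
Lemma offset_onto (z : int) : absz z <= n -> exists x, offset x = z.
Proof.
move=> z_le.
have [->|z_neq0] := eqVneq z 0%R; first by exists (center n).
have [|i i_lt ai] := a_covers (d := absz z); first lia.
have i1 : i < n by rewrite /n; lia.
have i2 : i + k < n by rewrite /n; lia.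
have e1 := a_anti i; have e2 := a_anti i.+1; rewrite addSn in e2.
case: ai => ai.
- have [e|e] : z = a i \/ z = (- a i)%R by lia.
  + by exists (vertex (Ordinal i1)).
  + by exists (vertex (Ordinal i2)); rewrite /= e1.
- have [e|e] : z = (a i + a i.+1)%R \/ z = (- (a i + a i.+1))%R by lia.
  + by exists (midpoint (Ordinal i2)); rewrite /= e1 e2; lia.
  + by exists (midpoint (Ordinal i1)).
Qed.

(** There are [2n + 1] nodes and as many integers of magnitude at most [n], so a
map onto the latter is injective and takes no other value.  The bound makes
[n + 1 + offset] positive, so that it can be read as a natural number. *)
Lemma offset_bij :
  injective offset /\ (forall x, absz (offset x) <= n).
Proof.
pose s := [seq (Posz d - Posz n.+1)%R | d <- iota 1 (2 * n + 1)].
have s_uniq : uniq s.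
  by rewrite map_inj_uniq ?iota_uniq // => d e; lia.
have s_sub : {subset s <= codom offset}.
  move=> _ /mapP [d] + ->; rewrite mem_iota => d_le.
  have [|x <-] := @offset_onto (Posz d - Posz n.+1)%R; first lia.
  exact: codom_f.
have size_s : size (codom offset) <= size s.
  by rewrite size_codom card_node size_map size_iota.
have [_ s_codom] := uniq_min_size s_uniq s_sub size_s.
split; first exact/injectiveP/(leq_size_uniq s_uniq s_sub size_s).
move=> x; have := codom_f offset x.
by rewrite -s_codom => /mapP [d]; rewrite mem_iota => d_le ->; lia.
Qed.

Lemma magic_of_offsets : exists f : node n -> nat, magic_ngon f.
Proof.
have [offset_inj offset_le] := offset_bij.
pose f (x : node n) := absz (Posz n.+1 + offset x)%R.
have fE x : Posz (f x) = (Posz n.+1 + offset x)%R.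
  by have := offset_le x; rewrite /f; lia.
have nE : n = k + k by rewrite /n; lia.
have n_half : n./2 = k by rewrite /n mul2n doubleK.
have n_even : odd n = false by rewrite /n mul2n odd_double.
exists f; split; first by rewrite /n; lia.
- split.
    move=> x y fxy; apply: offset_inj.
    by have := fE x; have := fE y; rewrite fxy; lia.
  move=> d; rewrite mem_iota; apply/codomP/idP => [[x ->]|d_le].
    by have := offset_le x; have := fE x; lia.
  have [|x ex] := @offset_onto (Posz d - Posz n.+1)%R; first lia.
  by exists x; have := fE x; lia.
- exists (3 * n.+1) => T; rewrite /diagonals n_even.
  rewrite !inE => /orP [|/orP []] /imsetP [i].
  + move=> _ ->; rewrite sum_set3 //.
      have := fE (vertex i); have := fE (midpoint i).
      have := fE (vertex (cyc_shift i 1)).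
      by rewrite /= antiperiodic_mod addn1; lia.
    have/contra_neq : i != cyc_shift i 1; last by apply=> -[].
    by apply: cyc_shift_neq; lia.
  + rewrite !inE n_half => i_lt ->; rewrite sum_set3 //.
      have := fE (vertex i); have := fE (center n).
      have := fE (vertex (cyc_shift i k)).
      by rewrite /= antiperiodic_mod a_anti; lia.
    have/contra_neq : i != cyc_shift i k; last by apply=> -[].
    by apply: cyc_shift_neq; lia.
  + rewrite !inE n_half => i_lt ->; rewrite sum_set3 //.
      have := fE (midpoint i); have := fE (center n).
      have := fE (midpoint (cyc_shift i k)).
      rewrite /= antiperiodic_mod modn_small; last lia.
      by rewrite -addSn !a_anti; lia.
    have/contra_neq : i != cyc_shift i k; last by apply=> -[].
    by apply: cyc_shift_neq; lia.
Qed.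

End Offsets.

Definition zigzag k i : int :=
  if i == k.-1 then 1%R
  else if odd i then (- Posz (2 * k - i./2))%R else Posz (k + 1 + i./2).

(** The division by [k] counts the half-turns, each of which flips the sign. *)
Definition antiperiodic_ext k (h : nat -> int) i : int :=
  if odd (i %/ k) then (- h (i %% k))%R else h (i %% k).

Lemma antiperiodic_extD k h i : 0 < k ->
  antiperiodic_ext k h (i + k) = (- antiperiodic_ext k h i)%R.
Proof.
move=> k_gt0; rewrite /antiperiodic_ext divnDr // divnn k_gt0 addn1 /= modnDr.
by case: odd; rewrite ?opprK.
Qed.

Lemma antiperiodic_ext_small k h i : i < k -> antiperiodic_ext k h i = h i.
Proof. by move=> i_lt; rewrite /antiperiodic_ext divn_small ?modn_small. Qed.

(** Each magnitude is located explicitly, by inverting the formulas: [1] at the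
last vertex, [2 .. k-1] at the midpoints inside the zigzag, [k] at the midpoint
between the last vertex and the antipode of the first one, the remaining ones
at the even-indexed (small) and odd-indexed (large) vertices, apart from the gap
between these two blocks, which sits at the midpoint before the last vertex. *)
Lemma zigzag_covers k d : 2 <= k -> 0 < d <= 2 * k ->
  let a := antiperiodic_ext k (zigzag k) in
  exists2 i, i < k & absz (a i) = d \/ absz (a i + a i.+1)%R = d.
Proof.
move=> k_ge2 d_le a; have aE i : i < k -> a i = zigzag k i.
  exact: antiperiodic_ext_small.
have vertex_case i : i < k -> absz (zigzag k i) = d ->
    exists2 i, i < k & absz (a i) = d \/ absz (a i + a i.+1)%R = d.
  by move=> i_lt e; exists i => //; left; rewrite aE.
have mid_case i : i.+1 < k -> absz (zigzag k i + zigzag k i.+1)%R = d ->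
    exists2 i, i < k & absz (a i) = d \/ absz (a i + a i.+1)%R = d.
  by move=> i_lt e; exists i; [lia | right; rewrite !aE //; lia].
have [d1|d_neq1] := eqVneq d 1.
  by apply: (vertex_case k.-1); rewrite ?/zigzag; do ?case: ifP => ?; lia.
have [d_lt|d_ge] := ltnP d k.
  by apply: (mid_case (k.-1 - d)); rewrite ?/zigzag; do ?case: ifP => ?; lia.
have [dk|d_neqk] := eqVneq d k.
  exists k.-1; first lia.
  have ak : a k = (- a 0)%R.
    by rewrite /a -antiperiodic_extD ?add0n //; lia.
  right; rewrite (ltn_predK k_ge2) ak !aE; try lia.
  by rewrite /zigzag; do ?case: ifP => ?; lia.
(* The gap [(3 * k)./2 + 1] separates the positive from the negative terms. *)
have [d_lt|d_gt|d_eq] := ltngtP d ((3 * k)./2 + 1).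
- by apply: (vertex_case (2 * (d - k - 1)));
    rewrite ?/zigzag; do ?case: ifP => ?; lia.
- by apply: (vertex_case (2 * (2 * k - d) + 1));
    rewrite ?/zigzag; do ?case: ifP => ?; lia.
- by apply: (mid_case (k - 2)); rewrite ?/zigzag; do ?case: ifP => ?; lia.
Qed.

Theorem theorem3p2 (n k : nat) (hk : 2 <= k) (hn : n = 2 * k) :
  exists f : node n -> nat, magic_ngon f.
Proof.
subst n; apply: (@magic_of_offsets k (antiperiodic_ext k (zigzag k))) => //.
- by move=> i; apply: antiperiodic_extD; lia.
- by move=> d; apply: zigzag_covers.
Qed.
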